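(* Let $\mathcal{S}[k]=\mathcal{X}^k\mathcal{Y}$, where $\mathcal{X}$ and $\mathcal{Y}$ are words on $\{L,R\}$, $\mathcal{X}$ is primitive and $\mathcal{X}_0\ne\mathcal{Y}_0$. Let $\tau_L,\delta_L,\tau_R,\delta_R\in\mathbb{R}$ and $\mu\ne0$. Suppose there exist infinitely many values of $k\ge1$ for which the border-collision normal form exhibits a unique, admissible, stable $\mathcal{S}[k]$-cycle that has no points on the switching manifold. Suppose that $M_{\mathcal{X}}$ has a repeated unit eigenvalue of geometric multiplicity $1$. Then the coefficients of the affine maps $$g^{\mathcal{X}}(w)=\begin{bmatrix}1&\omega_{12}\\ 0&1\end{bmatrix}w+\begin{bmatrix}\rho_1\\ \rho_2\end{bmatrix},\qquad g^{\mathcal{Y}}(w)=\begin{bmatrix}\gamma_{11}&\gamma_{12}\\ \gamma_{21}&\gamma_{22}\end{bmatrix}w+\begin{bmatrix}\sigma_1\\ \sigma_2\end{bmatrix}$$ (that is, $f^{\mathcal{X}}$ and $f^{\mathcal{Y}}$ written in the $(u,v)$-coordinates defined in the context) satisfy i) $\gamma_{21}=0$; ii) $\rho_2\ne0$; iii) $\gamma_{22}=-1$. Furthermore, the stability multipliers of the $\mathcal{S}[k]$-cycles are $\gamma_{11}$ and $-1$. The $\mathcal{S}[k]$-cycles are not attracting, and if $\delta_L=\delta_R=1$, then $\gamma_{11}=-1$.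
   Context: For real $\tau_L,\delta_L,\tau_R,\delta_R,\mu$ set $A_J=\begin{bmatrix}\tau_J&1\\ -\delta_J&0\end{bmatrix}$ and $f^J(x,y)=A_J\begin{bmatrix}x\\ y\end{bmatrix}+\begin{bmatrix}\mu\\ 0\end{bmatrix}$ for $J\in\{L,R\}$. The border-collision normal form is the continuous map of $\mathbb{R}^2$ equal to $f^L$ for $x\le0$ and $f^R$ for $x\ge0$; the switching manifold is $x=0$. A word $\mathcal{S}=\mathcal{S}_0\cdots\mathcal{S}_{n-1}$ on $\{L,R\}$ is primitive if it is not a power of a shorter word; primitive words are identified with periodic symbol sequences of minimal period $n$. $\mathcal{X}^k\mathcal{Y}$ denotes concatenation of $k$ copies of $\mathcal{X}$ followed by $\mathcal{Y}$. Put $f^{\mathcal{S}}=f^{\mathcal{S}_{n-1}}\circ\cdots\circ f^{\mathcal{S}_0}$, an affine map with matrix part $M_{\mathcal{S}}=A_{\mathcal{S}_{n-1}}\cdots A_{\mathcal{S}_0}$. An $\mathcal{S}$-cycle consists of points $(x_i^{\mathcal{S}},y_i^{\mathcal{S}})$, $i=0,\dots,n-1$, with $(x_0^{\mathcal{S}},y_0^{\mathcal{S}})$ a fixed point of $f^{\mathcal{S}}$ and $(x_{i+1}^{\mathcal{S}},y_{i+1}^{\mathcal{S}})=f^{\mathcal{S}_i}(x_i^{\mathcal{S}},y_i^{\mathcal{S}})$. It is unique if and only if $1$ is not an eigenvalue of $M_{\mathcal{S}}$. It is admissible if $x_i^{\mathcal{S}}\le0$ whenever $\mathcal{S}_i=L$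 and $x_i^{\mathcal{S}}\ge0$ whenever $\mathcal{S}_i=R$. It has no points on the switching manifold if $x_i^{\mathcal{S}}\neq0$ for all $i$. The stability multipliers of the $\mathcal{S}$-cycle are the eigenvalues of $M_{\mathcal{S}}$; an admissible $\mathcal{S}$-cycle with no points on the switching manifold is stable if both have modulus $\le1$, and attracting if both have modulus $<1$. The $(u,v)$-coordinates: under the hypotheses of the claim, $[0,1]^{\sf T}$ is not an eigenvector of $M_{\mathcal{X}}$, so the one-dimensional eigenspace of $M_{\mathcal{X}}$ is spanned by $[1,\nu]^{\sf T}$ for a unique $\nu\in\mathbb{R}$. Let $Q=\begin{bmatrix}1&0\\ \nu&1\end{bmatrix}$ and $w=\begin{bmatrix}u\\ v\end{bmatrix}=Q^{-1}\begin{bmatrix}x\\ y\end{bmatrix}$. For any word $\mathcal{S}$, $g^{\mathcal{S}}$ denotes $f^{\mathcal{S}}$ expressed in $(u,v)$-coordinates. Then $g^{\mathcal{X}}$ has the form displayed in the claim with $\omega_{12}\neq0$, and the displayed formulas define the real constants $\omega_{12},\rho_i,\gamma_{ij},\sigma_i$. *)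

(* Defs.v *)
From mathcomp Require Import all_boot all_order all_algebra.
From mathcomp Require Import boolp classical_sets cardinality reals.
From mathcomp Require Import complex.

Set Implicit Arguments.
Unset Strict Implicit.
Unset Printing Implicit Defensive.

Import Order.TTheory GRing.Theory Num.Theory.
Local Open Scope ring_scope.

Definition cvec (K : realType) (a b : K) : 'cV[K]_2 :=
  \col_i (if i == 0 then a else b).

Definition mat2 (K : realType) (a b c d : K) : 'M[K]_2 :=
  \matrix_(i, j) (if i == 0 then (if j == 0 then a else b)
                  else (if j == 0 then c else d)).

Inductive letter : Set := L | R.

Definition word : Set := seq letter.

Definition primitive (S : word) : Prop :=
  forall (W : word) (m : nat),
    (size W < size S)%N -> S <> flatten (nseq m W).

Definition XkY (X Y : word) (k : nat) : word := flatten (nseq k X) ++ Y.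

Record bcnf (K : realType) : Type := Bcnf {
  tauL : K; deltaL : K; tauR : K; deltaR : K; mu : K }.

Section BorderCollision.
Context {K : realType} (p : bcnf K).

Definition A (J : letter) : 'M[K]_2 :=
  match J with
  | L => mat2 (tauL p) 1 (- deltaL p) 0
  | R => mat2 (tauR p) 1 (- deltaR p) 0
  end.

Definition f (J : letter) (z : 'cV[K]_2) : 'cV[K]_2 :=
  A J *m z + cvec (mu p) 0.

(* The first letter of the word is applied first. *)
Definition fword (S : word) (z : 'cV[K]_2) : 'cV[K]_2 :=
  foldl (fun z' J => f J z') z S.

Definition M (S : word) : 'M[K]_2 :=
  foldl (fun P J => A J *m P) 1%:M S.

(* An S-cycle is represented by its initial point (x_0, y_0), which determines
   the other points: [cycle_point S z i] is (x_i, y_i). *)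
Definition is_cycle (S : word) (z : 'cV[K]_2) : Prop := fword S z = z.

Definition cycle_point (S : word) (z : 'cV[K]_2) (i : nat) : 'cV[K]_2 :=
  fword (take i S) z.

Definition xcoord (z : 'cV[K]_2) : K := z 0 0.

Definition admissible (S : word) (z : 'cV[K]_2) : Prop :=
  forall i, (i < size S)%N ->
    match nth L S i with
    | L => xcoord (cycle_point S z i) <= 0
    | R => 0 <= xcoord (cycle_point S z i)
    end.

Definition off_switching_manifold (S : word) (z : 'cV[K]_2) : Prop :=
  forall i, (i < size S)%N -> xcoord (cycle_point S z i) != 0.

(* The complex eigenvalues of [M S], repeated according to their algebraic
   multiplicity, in an unspecified order. *)
Definition stability_multipliers (S : word) : seq K[i] :=
  sval (closed_field_poly_normal (char_poly (map_mx (real_complex K) (M S)))).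

(* [stable] and [attracting] depend on the cycle only through its word. *)
Definition stable (S : word) : bool :=
  all (fun l : K[i] => `|l| <= 1) (stability_multipliers S).

Definition attracting (S : word) : bool :=
  all (fun l : K[i] => `|l| < 1) (stability_multipliers S).

(* [eigenspace] consists of row (left) eigenvectors, hence the transposes. *)
Definition col_eigenspace (B : 'M[K]_2) (a : K) : 'M[K]_2 :=
  eigenspace B^T a.

Definition algebraic_multiplicity (B : 'M[K]_2) (a : K) : nat :=
  mup a (char_poly B).

Definition geometric_multiplicity (B : 'M[K]_2) (a : K) : nat :=
  \rank (col_eigenspace B a).

(* For [M X] with the single eigenvalue 1: its eigenspace is spanned by
   the column vector (1, nu). *)
Definition eigenslope (X : word) (nu : K) : Prop :=
  (col_eigenspace (M X) 1 == (cvec 1 nu)^T)%MS.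

Definition Q (nu : K) : 'M[K]_2 := mat2 1 0 nu 1.

Definition gword (nu : K) (S : word) (w : 'cV[K]_2) : 'cV[K]_2 :=
  invmx (Q nu) *m fword S (Q nu *m w).

End BorderCollision.

(* Main.v *)
(* In the (u,v)-coordinates u = x, and M_X is a unipotent shear, so the trace of
   M_{S[k]} is an affine function of k with slope omega12 * gamma21.  Stability
   bounds it, which forces gamma21 = 0; hence v evolves on its own.  Solving for
   the cycle, u at the start of Y is a quadratic polynomial in k with leading
   coefficient proportional to omega12 * rho2 * (1 + gamma22), and one iterate of
   X earlier it is the same up to lower-order terms.  As X_0 <> Y_0, these two
   values have opposite signs for infinitely many k, so the leading coefficient
   vanishes.  If rho2 = 0, the two polynomials are affine with equal slope, and
   once that slope vanishes they coincide; hence rho2 <> 0 and gamma22 = -1. *)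

Require Import Defs.
From mathcomp Require Import all_boot all_order all_algebra.
From mathcomp Require Import boolp classical_sets cardinality reals.
From mathcomp Require Import complex ring lra.

Set Implicit Arguments.
Unset Strict Implicit.
Unset Printing Implicit Defensive.

Import Order.TTheory GRing.Theory Num.Theory.
Local Open Scope ring_scope.
Local Open Scope complex_scope.
Local Open Scope classical_set_scope.

Definition frequently (P : nat -> Prop) : Prop :=
  forall N : nat, exists2 k, (N <= k)%N & P k.

Lemma infinite_frequently (A : set nat) : infinite_set A -> frequently A.
Proof.
move=> infA N; apply: contrapT => nA; apply: infA.
apply: sub_finite_set (finite_II N) => k Ak /=.
by rewrite ltnNge; apply/negP => Nk; apply: nA; exists k.
Qed.

Lemma frequentlyS (P P' : nat -> Prop) :
  (forall k, P k -> P' k) -> frequently P -> frequently P'.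
Proof. by move=> PP' fP N; have [k Nk /PP' Pk] := fP N; exists k. Qed.

Section RealPolynomials.
Context {K : realType}.

Lemma quadratic_sign_change (a b c b' c' : K) :
  frequently (fun k => (a * k%:R ^+ 2 + b * k%:R + c) *
                       (a * k%:R ^+ 2 + b' * k%:R + c') < 0) -> a = 0.
Proof.
move=> freq; apply/eqP/negPn/negP => a0.
pose B := (`|b| + `|c| + `|b'| + `|c'|) / `|a|.
have na : 0 < `|a| by rewrite normr_gt0.
have B0 : 0 <= B by rewrite divr_ge0 ?addr_ge0.
have [k Nk] := freq (Num.bound B).+1.
apply/negP; rewrite -leNgt.
have k1 : 1 <= k%:R :> K by rewrite ler1n (leq_trans _ Nk).
have kB : `|b| + `|c| + `|b'| + `|c'| < `|a| * k%:R.
  rewrite mulrC -ltr_pdivrMr //; apply: lt_le_trans (archi_boundP B0) _.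
  by rewrite ler_nat ltnW.
have k0 : 0 < k%:R :> K by lra.
(* The quadratic coefficient dominates, so both factors have its sign. *)
have dom s t : `|s| + `|t| <= `|b| + `|c| + `|b'| + `|c'| ->
    0 <= a * (a * k%:R ^+ 2 + s * k%:R + t).
  move=> st.
  have -> : a * (a * k%:R ^+ 2 + s * k%:R + t) =
    `|a| ^+ 2 * k%:R ^+ 2 + a * (s * k%:R + t) by rewrite real_normK ?num_real; ring.
  suff: `|a * (s * k%:R + t)| <= `|a| ^+ 2 * k%:R ^+ 2.
    by rewrite ler_norml => /andP[]; lra.
  rewrite normrM (_ : `|a| ^+ 2 * _ = `|a| * (`|a| * k%:R * k%:R)); last by ring.
  apply: ler_wpM2l => //; apply: (@le_trans _ _ ((`|s| + `|t|) * k%:R)).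
    rewrite (le_trans (ler_normD _ _)) // normrM normr_nat mulrDl lerD2l.
    by rewrite ler_peMr.
  by apply: ler_wpM2r; lra.
have P1 := dom b c; have P2 := dom b' c'.
have /P1 {}P1 : `|b| + `|c| <= `|b| + `|c| + `|b'| + `|c'|.
  by have := normr_ge0 b'; have := normr_ge0 c'; lra.
have /P2 {}P2 : `|b'| + `|c'| <= `|b| + `|c| + `|b'| + `|c'|.
  by have := normr_ge0 b; have := normr_ge0 c; lra.
have a2 : 0 < a ^+ 2 by rewrite exprn_even_gt0.
rewrite -(pmulr_rge0 _ a2).
rewrite (_ : a ^+ 2 * _ = a * (a * k%:R ^+ 2 + b * k%:R + c) *
  (a * (a * k%:R ^+ 2 + b' * k%:R + c'))); last by ring.
by apply: mulr_ge0.
Qed.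

Lemma linear_sign_change (b c c' : K) :
  frequently (fun k => (b * k%:R + c) * (b * k%:R + c') < 0) -> b = 0.
Proof.
move=> freq; apply: (@quadratic_sign_change b c 0 c' 0) => N.
have [k Nk bk] := freq N.+1; exists k; first exact: ltnW.
have k0 : 0 < k%:R :> K by rewrite ltr0n (leq_trans _ Nk).
rewrite [ltLHS](_ : _ = k%:R ^+ 2 * ((b * k%:R + c) * (b * k%:R + c')));
  last by ring.
by rewrite pmulr_rlt0 // exprn_gt0.
Qed.

Lemma bounded_linear (b c B : K) :
  frequently (fun k => `|b * k%:R + c| <= B) -> b = 0.
Proof.
move=> freq; apply: (@linear_sign_change b (c - B - 1) (c + B + 1)) => N.
have [k Nk bk] := freq N; exists k => //.
by move: bk; rewrite ler_norml => /andP[]; nra.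
Qed.

End RealPolynomials.

(* The S[k]-cycle sampled at the start of each X (j < k) and at the start of Y
   (j = k), in coordinates in which M_X is a Jordan block and M_Y is upper
   triangular. *)
Record shear_orbit (K : realType) (om r1 r2 g11 g12 g22 s1 s2 : K)
  (k : nat) (u v : nat -> K) : Prop := ShearOrbit {
  shear_u : forall j, u j.+1 = u j + om * v j + r1;
  shear_v : forall j, v j.+1 = v j + r2;
  return_u : u 0%N = g11 * u k + g12 * v k + s1;
  return_v : v 0%N = g22 * v k + s2 }.

Section ShearOrbits.
Context {K : realType} (om r1 r2 g11 g12 g22 s1 s2 : K).
Let orbit := shear_orbit om r1 r2 g11 g12 g22 s1 s2.
Context (g11N1 : g11 != 1) (g22N1 : g22 != 1).

Lemma shear_vE k u v j : orbit k u v -> v j = v 0%N + j%:R * r2.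
Proof.
move=> [_ vS _ _]; elim: j => [|j IH]; first by ring.
by rewrite vS IH -[j.+1]addn1 natrD; ring.
Qed.

Lemma shear_uE k u v j : orbit k u v ->
  2 * u j = 2 * u 0%N + 2 * j%:R * (om * v 0%N + r1)
            + om * r2 * (j%:R ^+ 2 - j%:R).
Proof.
move=> o; have [uS _ _ _] := o; elim: j => [|j IH]; first by ring.
rewrite uS 2!mulrDr IH (shear_vE j o) -[j.+1]addn1 natrD; ring.
Qed.

Lemma orbit_vk k u v : orbit k u v -> (1 - g22) * v k = s2 + k%:R * r2.
Proof.
move=> o; have := shear_vE k o; rewrite (return_v o) => e.
by rewrite mulrBl mul1r {1}e; ring.
Qed.

Lemma orbit_uk k u v : orbit k u v ->
  2 * (1 - g22) * (1 - g11) * u k =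
    om * r2 * (1 + g22) * k%:R ^+ 2
    + (2 * (1 - g22) * r1 + 2 * g12 * r2 + 2 * om * s2
       - (1 - g22) * om * r2) * k%:R
    + (2 * (1 - g22) * s1 + 2 * g12 * s2).
Proof.
move=> o; have vk := orbit_vk o; have v0 := shear_vE k o.
have := shear_uE k o; rewrite (return_u o).
have -> : v 0%N = v k - k%:R * r2 by rewrite v0; ring.
move=> uk.
have -> : 2 * (1 - g22) * (1 - g11) * u k =
  (1 - g22) * (2 * u k) - 2 * (1 - g22) * g11 * u k by ring.
rewrite uk.
transitivity (2 * (g12 + k%:R * om) * ((1 - g22) * v k)
  + 2 * (1 - g22) * (s1 + k%:R * r1)
  - (1 - g22) * om * r2 * (k%:R ^+ 2 + k%:R)); first by ring.
by rewrite vk; ring.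
Qed.

Lemma orbit_u_pred k u v : orbit k.+1 u v ->
  2 * (1 - g22) * (1 - g11) * u k =
    2 * (1 - g22) * (1 - g11) * u k.+1
    - 2 * (1 - g11) * om * r2 * k.+1%:R
    + 2 * (1 - g11) * ((1 - g22) * (om * r2 - r1) - om * s2).
Proof.
move=> o; have vk := orbit_vk o.
rewrite (shear_u o k).
have e : (1 - g22) * v k = s2 + k.+1%:R * r2 - (1 - g22) * r2.
  by rewrite -vk (shear_v o k); ring.
transitivity (2 * (1 - g22) * (1 - g11) * (u k + om * v k + r1)
  - 2 * (1 - g11) * om * ((1 - g22) * v k) - 2 * (1 - g22) * (1 - g11) * r1).
  by ring.
by rewrite e; ring.
Qed.

Lemma orbit_v_no_sign_change :
  ~ frequently (fun k => exists2 uv, orbit k.+1 uv.1 uv.2 &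
                                     uv.2 k * uv.2 k.+1 < 0).
Proof.
move=> freq.
have h k u v : orbit k.+1 u v -> v k * v k.+1 < 0 ->
    (r2 * k%:R + (s2 + g22 * r2)) * (r2 * k%:R + (s2 + r2)) < 0.
  move=> o neg; have vk := orbit_vk o.
  rewrite (_ : r2 * _ + (s2 + r2) = (1 - g22) * v k.+1); last first.
    by rewrite vk -[k.+1]addn1 natrD; ring.
  rewrite (_ : r2 * _ + (s2 + g22 * r2) = (1 - g22) * v k); last first.
    rewrite (_ : v k = v k.+1 - r2); last by rewrite (shear_v o); ring.
    by rewrite mulrBr vk -[k.+1]addn1 natrD; ring.
  rewrite [ltLHS](_ : _ = (1 - g22) ^+ 2 * (v k * v k.+1)); last by ring.
  by rewrite pmulr_rlt0 // exprn_even_gt0 //= subr_eq0 eq_sym.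
have {h}freq' : frequently (fun k =>
    (r2 * k%:R + (s2 + g22 * r2)) * (r2 * k%:R + (s2 + r2)) < 0).
  by apply: frequentlyS freq => k [[u v] /= o neg]; exact: h o neg.
have r20 := linear_sign_change freq'.
have [k _] := freq' 0%N; rewrite r20.
by apply/negP; rewrite -leNgt !mulr0 !mul0r !addr0 !add0r -expr2 sqr_ge0.
Qed.

Lemma orbit_u_sign_change : om != 0 ->
  frequently (fun k => exists2 uv, orbit k.+1 uv.1 uv.2 &
                                   uv.1 k * uv.1 k.+1 < 0) ->
  r2 != 0 /\ g22 = -1.
Proof.
move=> om0 freq.
set c := 2 * (1 - g22) * (1 - g11).
have c0 : c != 0 by rewrite !mulf_neq0 ?pnatr_eq0 // subr_eq0 eq_sym.
pose a := om * r2 * (1 + g22).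
pose b := 2 * (1 - g22) * r1 + 2 * g12 * r2 + 2 * om * s2
          - (1 - g22) * om * r2.
pose d := 2 * (1 - g22) * s1 + 2 * g12 * s2.
pose b' := b - 2 * (1 - g11) * om * r2.
pose d' := d + 2 * (1 - g11) * ((1 - g22) * (om * r2 - r1) - om * s2).
have freq' : frequently (fun k =>
    (a * k%:R ^+ 2 + b' * k%:R + d') * (a * k%:R ^+ 2 + b * k%:R + d) < 0).
  move=> N; have [k Nk [[u v] /= o neg]] := freq N.
  exists k.+1; first by rewrite (leq_trans Nk).
  have e := orbit_uk o; have e' := orbit_u_pred o; rewrite e in e'.
  rewrite (_ : a * _ + b' * _ + d' = c * u k); last first.
    by rewrite e' /a /b' /b /d' /d; ring.
  rewrite -e -/c [ltLHS](_ : _ = c ^+ 2 * (u k * u k.+1)); last by ring.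
  by rewrite pmulr_rlt0 // exprn_even_gt0.
have a0 := quadratic_sign_change freq'.
have r20 : r2 != 0.
  apply/eqP => r2E.
  have bE : b' = b by rewrite /b' r2E; ring.
  rewrite a0 bE in freq'.
  have b0 : b = 0.
    apply: (@linear_sign_change _ b d' d).
    by apply: frequentlyS freq' => k; rewrite !mul0r !add0r.
  have dE : d' = d - (1 - g11) * b by rewrite /d' /b r2E; ring.
  have [k _] := freq' 0%N; apply/negP; rewrite dE b0 -leNgt.
  by rewrite !mul0r !mulr0 !subr0 !add0r -expr2 sqr_ge0.
split=> //; move/eqP: a0; rewrite /a !mulf_eq0 (negPf om0) (negPf r20) /=.
by rewrite addr_eq0 => /eqP ->; rewrite opprK.
Qed.

End ShearOrbits.

Lemma ord2P (i : 'I_2) : i = 0 \/ i = 1.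
Proof. by case: i => -[|[|//]] h; [left|right]; apply: val_inj. Qed.

Lemma det_mx22 (F : comNzRingType) (B : 'M[F]_2) :
  \det B = B 0 0 * B 1 1 - B 0 1 * B 1 0.
Proof.
rewrite (expand_det_row _ 0) big_ord_recl big_ord1 /cofactor !det_mx11 !mxE /=.
have e1 : lift ord0 ord0 = 1 :> 'I_2 by exact: val_inj.
have e0 : lift 1 ord0 = 0 :> 'I_2 by exact: val_inj.
by rewrite ?e1 ?e0 expr0 expr1 mul1r mulN1r mulrN.
Qed.

Lemma mxtrace_mx22 (F : nzRingType) (B : 'M[F]_2) : \tr B = B 0 0 + B 1 1.
Proof.
rewrite /mxtrace big_ord_recl big_ord1 (_ : lift ord0 ord0 = 1) //.
exact: val_inj.
Qed.

Section TwoByTwo.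
Context {K : realType}.
Implicit Types (B : 'M[K]_2) (z : 'cV[K]_2).

Lemma mat2_eta B : mat2 (B 0 0) (B 0 1) (B 1 0) (B 1 1) = B.
Proof.
by apply/matrixP => i j; rewrite mxE; case: (ord2P i) => ->; case: (ord2P j) => ->.
Qed.

Lemma cvec_eta z : cvec (z 0 0) (z 1 0) = z.
Proof. by apply/colP => i; rewrite mxE; case: (ord2P i) => ->. Qed.

Lemma mat2M (a b c d a' b' c' d' : K) :
  mat2 a b c d *m mat2 a' b' c' d' =
  mat2 (a * a' + b * c') (a * b' + b * d') (c * a' + d * c') (c * b' + d * d').
Proof.
apply/matrixP => i j; rewrite !mxE big_ord_recl big_ord1 !mxE /=.
by case: (ord2P i) => ->; case: (ord2P j) => ->.
Qed.

Lemma mat2_cvec (a b c d x y : K) :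
  mat2 a b c d *m cvec x y = cvec (a * x + b * y) (c * x + d * y).
Proof.
apply/colP => i; rewrite !mxE big_ord_recl big_ord1 !mxE /=.
by case: (ord2P i) => ->.
Qed.

Lemma cvecD (x y x' y' : K) : cvec x y + cvec x' y' = cvec (x + x') (y + y').
Proof. by apply/colP => i; rewrite !mxE; case: (ord2P i) => ->. Qed.

Lemma mat2_1 : mat2 1 0 0 1 = 1%:M :> 'M[K]_2.
Proof.
by apply/matrixP => i j; rewrite !mxE; case: (ord2P i) => ->; case: (ord2P j) => ->.
Qed.

Lemma det_mat2 (a b c d : K) : \det (mat2 a b c d) = a * d - b * c.
Proof. by rewrite det_mx22 !mxE. Qed.

Lemma mxtrace_mat2 (a b c d : K) : \tr (mat2 a b c d) = a + d.
Proof. by rewrite mxtrace_mx22 !mxE. Qed.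

End TwoByTwo.

Lemma char_poly_mx22 (F : comNzRingType) (B : 'M[F]_2) :
  char_poly B = 'X^2 - \tr B *: 'X + (\det B)%:P.
Proof.
have c0 := char_poly_det B; have c1 := char_poly_trace B (isT : (0 < 2)%N).
have := char_poly_monic B; rewrite monicE lead_coefE size_char_poly => /eqP c2.
have c3 i : (char_poly B)`_i.+3 = 0 by rewrite nth_default ?size_char_poly.
move: (char_poly B) c0 c1 c2 c3 => q /= c0 c1 c2 c3.
apply/polyP => -[|[|[|i]]]; rewrite !coefE /= ?c0 ?c1 ?c2 ?c3; ring.
Qed.

Lemma mul_XsubC2 (F : comNzRingType) (a d : F) :
  ('X - a%:P) * ('X - d%:P) = 'X^2 - (a + d) *: 'X + (a * d)%:P.
Proof. by rewrite -mul_polyC polyCD polyCM; ring. Qed.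

Lemma monic_quadratic_inj (F : comNzRingType) (s d s' d' : F) :
  'X^2 - s *: 'X + d%:P = 'X^2 - s' *: 'X + d'%:P -> s = s' /\ d = d'.
Proof.
move/polyP => e; have := e 1%N; have := e 0%N; rewrite !coefE /=.
by rewrite !mulr0 !mulr1 !oppr0 !sub0r !add0r !addr0 => -> /oppr_inj ->.
Qed.

Section Multipliers.
Context {K : realType} (p : bcnf K) (S : word).

Lemma prod_stability_multipliers :
  \prod_(z <- stability_multipliers p S) ('X - z%:P) =
  'X^2 - (\tr (M p S))%:C *: 'X + ((\det (M p S))%:C)%:P.
Proof.
have := svalP (closed_field_poly_normal
  (char_poly (map_mx (real_complex K) (M p S)))).
rewrite -/(stability_multipliers p S) (monicP (char_poly_monic _)) scale1r => <-.
by rewrite char_poly_mx22 trace_map_mx det_map_mx.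
Qed.

Lemma stability_multipliersP (a d : K) :
  \tr (M p S) = a + d -> \det (M p S) = a * d ->
  perm_eq (stability_multipliers p S) [:: a%:C; d%:C].
Proof.
move=> trE detE; apply: prod_XsubC_eq.
rewrite prod_stability_multipliers big_cons big_seq1 mul_XsubC2.
by rewrite trE detE rmorphD rmorphM.
Qed.

Lemma stable_mxtrace : stable p S -> `|\tr (M p S)| <= 2.
Proof.
rewrite /stable; have := prod_stability_multipliers.
set s := stability_multipliers p S => e.
have ss : size s = 2%N.
  have := congr1 (fun q : {poly K[i]} => size q) e; rewrite size_prod_XsubC.
  have -> : (\tr (M p S))%:C = \tr (map_mx (real_complex K) (M p S)).
    by rewrite trace_map_mx.
  have -> : (\det (M p S))%:C = \det (map_mx (real_complex K) (M p S)).
    by rewrite det_map_mx.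
  by rewrite -char_poly_mx22 size_char_poly => -[].
case: s ss e => [|l1 [|l2 [|//]]] // _.
rewrite big_cons big_seq1 mul_XsubC2.
move=> /monic_quadratic_inj[trE _] /and3P[n1 n2 _].
rewrite -lecR (le_trans (normc_ge_Re (\tr (M p S))%:C)) // -trE.
by rewrite (le_trans (ler_normD _ _)) // (_ : 2%:C = 1 + 1) ?lerD // rmorph_nat.
Qed.

End Multipliers.

Section Words.
Context {K : realType} (p : bcnf K).
Implicit Types (S T X Y : word) (z w : 'cV[K]_2) (P : 'M[K]_2).

Lemma fword_cat S T z : fword p (S ++ T) z = fword p T (fword p S z).
Proof. exact: foldl_cat. Qed.

Lemma M_cat S T : M p (S ++ T) = M p T *m M p S.
Proof.
elim/last_ind: T => [|T J IH]; first by rewrite cats0 mul1mx.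
by rewrite -rcons_cat /M !foldl_rcons -/(M p _) IH mulmxA.
Qed.

Lemma fwordE S z : fword p S z = M p S *m z + fword p S 0.
Proof.
elim/last_ind: S z => [|S J IH] z; first by rewrite mul1mx addr0.
rewrite /fword /M !foldl_rcons -/(fword p _ _) -/(M p _) /f IH.
by rewrite mulmxDr mulmxA addrA.
Qed.

Lemma unique_cycle_det S z : unique (is_cycle p S) z -> \det (1%:M - M p S) != 0.
Proof.
move=> [zS uz]; rewrite -det_tr; apply/det0P => -[v v0 vE].
have {vE}Mv : M p S *m v^T = v^T.
  apply/esym/eqP; rewrite -subr_eq0 -{1}[v^T]mul1mx -mulmxBl.
  by rewrite -[_ *m v^T]trmxK trmx_mul trmxK vE trmx0.
have /uz : is_cycle p S (z + v^T).
  by rewrite /is_cycle fwordE mulmxDr Mv addrAC -fwordE zS.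
move/eqP; rewrite -subr_eq0 opprD addNKr oppr_eq0 => /eqP/(congr1 trmx).
by rewrite trmxK trmx0 => /eqP; rewrite (negPf v0).
Qed.

Lemma take_XkY X Y k j : (j <= k)%N ->
  take (j * size X) (XkY X Y k) = flatten (nseq j X).
Proof.
move=> jk; rewrite /XkY -(subnKC jk) nseqD flatten_cat -catA take_size_cat //.
by rewrite size_flatten /shape map_nseq sumn_nseq mulnC.
Qed.

Lemma cycle_sign_change X Y k z : X <> [::] -> Y <> [::] ->
  nth L X 0 <> nth L Y 0 ->
  admissible p (XkY X Y k.+1) z -> off_switching_manifold p (XkY X Y k.+1) z ->
  xcoord (fword p (flatten (nseq k X)) z) *
  xcoord (fword p (flatten (nseq k.+1 X)) z) < 0.
Proof.
move=> X0 Y0 XY adm off.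
have szX : (0 < size X)%N by case: (X) X0.
have szY : (0 < size Y)%N by case: (Y) Y0.
have sz j : size (flatten (nseq j X)) = (j * size X)%N.
  by rewrite size_flatten /shape map_nseq sumn_nseq mulnC.
have lt1 : (k.+1 * size X < size (XkY X Y k.+1))%N.
  by rewrite size_cat sz -{1}[(_ * _)%N]addn0 ltn_add2l.
have lt0 : (k * size X < size (XkY X Y k.+1))%N.
  by apply: leq_ltn_trans lt1; rewrite leq_mul2r leqnSn orbT.
have l1 : nth L (XkY X Y k.+1) (k.+1 * size X) = nth L Y 0.
  by rewrite nth_cat sz ltnn subnn.
have l0 : nth L (XkY X Y k.+1) (k * size X) = nth L X 0.
  rewrite /XkY -addn1 nseqD flatten_cat -catA nth_cat sz ltnn subnn /= cats0.
  by rewrite nth_cat szX.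
have := adm _ lt1; have := off _ lt1; have := adm _ lt0; have := off _ lt0.
rewrite /cycle_point !take_XkY // l1 l0.
set x0 := xcoord _; set x1 := xcoord _.
case: (nth L X 0) (nth L Y 0) XY => -[] // _ x00 s0 x10 s1.
- by rewrite nmulr_rlt0 lt_neqAle ?x00 // eq_sym x10.
- by rewrite pmulr_rlt0 lt_neqAle ?x10 // eq_sym x00.
Qed.

End Words.

Definition good_period {K : realType} (p : bcnf K) (X Y : word) (k : nat) : Prop :=
  (1 <= k)%N /\
  exists z : 'cV[K]_2,
    [/\ unique (is_cycle p (XkY X Y k)) z,
        admissible p (XkY X Y k) z,
        stable p (XkY X Y k) &
        off_switching_manifold p (XkY X Y k) z].

Section Coordinates.
Context {K : realType} (p : bcnf K) (P : 'M[K]_2).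
Context (P_unit : P \in unitmx).
Implicit Types (S T X Y : word) (z w : 'cV[K]_2).

Definition conjM S : 'M[K]_2 := invmx P *m M p S *m P.

Definition conjw S w : 'cV[K]_2 := invmx P *m fword p S (P *m w).

Lemma conjwE S w : conjw S w = conjM S *m w + conjw S 0.
Proof. by rewrite /conjw fwordE mulmxDr mulmx0 !mulmxA. Qed.

Lemma conjM_cat S T : conjM (S ++ T) = conjM T *m conjM S.
Proof. by rewrite /conjM M_cat !mulmxA mulmxK. Qed.

Lemma mxtrace_conjM S : \tr (conjM S) = \tr (M p S).
Proof. by rewrite /conjM mxtrace_mulC mulmxA mulmxV // mul1mx. Qed.

Lemma det_conjM S : \det (conjM S) = \det (M p S).
Proof. by rewrite !det_mulmx mulrAC -det_mulmx mulVmx // det1 mul1r. Qed.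

Context (X Y : word) (om r1 r2 g11 g12 g21 g22 s1 s2 : K).
Context (MX : conjM X = mat2 1 om 0 1) (X0 : conjw X 0 = cvec r1 r2).
Context (MY : conjM Y = mat2 g11 g12 g21 g22) (Y0 : conjw Y 0 = cvec s1 s2).

Lemma conjM_nseq k : conjM (flatten (nseq k X)) = mat2 1 (k%:R * om) 0 1.
Proof.
elim: k => [|k IH]; first by rewrite /conjM mulmx1 mulVmx // mul0r mat2_1.
by rewrite /= conjM_cat IH MX mat2M -[k.+1]addn1 natrD; congr mat2; ring.
Qed.

Lemma conjM_XkY k :
  conjM (XkY X Y k) =
  mat2 g11 (g11 * (k%:R * om) + g12) g21 (g21 * (k%:R * om) + g22).
Proof. by rewrite conjM_cat conjM_nseq MY mat2M; congr mat2; ring. Qed.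

Lemma mxtrace_XkY k : \tr (M p (XkY X Y k)) = om * g21 * k%:R + (g11 + g22).
Proof. by rewrite -mxtrace_conjM conjM_XkY mxtrace_mat2; ring. Qed.

Lemma det_XkY k : \det (M p (XkY X Y k)) = g11 * g22 - g12 * g21.
Proof. by rewrite -det_conjM conjM_XkY det_mat2; ring. Qed.

Lemma stable_g21 :
  om != 0 -> frequently (fun k => stable p (XkY X Y k)) -> g21 = 0.
Proof.
move=> om0 freq; have /eqP : om * g21 = 0.
  apply: (@bounded_linear _ _ (g11 + g22) 2).
  by apply: frequentlyS freq => k /stable_mxtrace; rewrite mxtrace_XkY.
by rewrite mulf_eq0 (negPf om0) => /eqP.
Qed.

Lemma unique_cycle_g k z :
  g21 = 0 -> unique (is_cycle p (XkY X Y k)) z -> g11 != 1 /\ g22 != 1.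
Proof.
move=> g0 /unique_cycle_det.
have -> : \det (1%:M - M p (XkY X Y k)) = (1 - g11) * (1 - g22).
  transitivity (\det (invmx P *m (1%:M - M p (XkY X Y k)) *m P)).
    by rewrite !det_mulmx mulrAC -det_mulmx mulVmx // det1 mul1r.
  rewrite mulmxBr mulmxBl mulmx1 mulVmx // -/(conjM _) conjM_XkY g0 -mat2_1.
  set B := mat2 _ _ _ _; set C := mat2 _ _ _ _.
  by rewrite -[B - C]mat2_eta det_mat2 !mxE /=; ring.
by rewrite mulf_eq0 negb_or !subr_eq0 !(eq_sym 1) => /andP[].
Qed.

Lemma cycle_shear_orbit k z : g21 = 0 -> is_cycle p (XkY X Y k) z ->
  let w j := invmx P *m fword p (flatten (nseq j X)) z in
  shear_orbit om r1 r2 g11 g12 g22 s1 s2 k (fun j => w j 0 0) (fun j => w j 1 0).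
Proof.
move=> g0 zc w.
have wS j : w j.+1 = conjw X (w j).
  by rewrite /w /conjw mulKVmx // -[j.+1]addn1 nseqD flatten_cat /= cats0 fword_cat.
have w0 : w 0%N = conjw Y (w k).
  by rewrite /w /conjw mulKVmx // -fword_cat -/(XkY X Y k) zc.
split=> [j|j||].
- by rewrite wS conjwE MX X0 -{1}[w j]cvec_eta mat2_cvec cvecD !mxE /=; ring.
- by rewrite wS conjwE MX X0 -{1}[w j]cvec_eta mat2_cvec cvecD !mxE /=; ring.
- by rewrite w0 conjwE MY Y0 -{1}[w k]cvec_eta mat2_cvec cvecD !mxE /=; ring.
- by rewrite w0 conjwE MY Y0 g0 -{1}[w k]cvec_eta mat2_cvec cvecD !mxE /=; ring.
Qed.

Lemma cycles_shear_orbits :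
  X <> [::] -> Y <> [::] -> nth L X 0 <> nth L Y 0 -> om != 0 ->
  frequently (good_period p X Y) ->
  [/\ g21 = 0, g11 != 1, g22 != 1 &
    frequently (fun k => exists2 uv,
      shear_orbit om r1 r2 g11 g12 g22 s1 s2 k.+1 uv.1 uv.2 &
      xcoord (P *m cvec (uv.1 k) (uv.2 k)) *
      xcoord (P *m cvec (uv.1 k.+1) (uv.2 k.+1)) < 0)].
Proof.
move=> Xn Yn XY om0 freq.
have g0 : g21 = 0.
  by apply: stable_g21 => //; apply: frequentlyS freq => k [_ [z []]].
have [k _ [_ [z [uz _ _ _]]]] := freq 0%N.
have [g11N1 g22N1] := unique_cycle_g g0 uz.
split=> // N; have {k z uz}[[|k] Nk [// _ [z [uz az _ oz]]]] := freq N.+1.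
exists k => //.
pose w j := invmx P *m fword p (flatten (nseq j X)) z.
exists (fun j => w j 0 0, fun j => w j 1 0).
  by apply: cycle_shear_orbit => //; case: uz.
by rewrite /= !cvec_eta !mulKVmx //; exact: cycle_sign_change az oz.
Qed.

End Coordinates.

Lemma double_unit_eigenvalue {K : realType} (B : 'M[K]_2) :
  algebraic_multiplicity B 1 = 2%N ->
  B 0 0 + B 1 1 = 2 /\ B 0 0 * B 1 1 - B 0 1 * B 1 0 = 1.
Proof.
move=> mB; have chi0 : char_poly B != 0 by rewrite monic_neq0 ?char_poly_monic.
have : (('X - 1%:P) ^+ 2 %| char_poly B)%R.
  by rewrite -mup_geq // -[mup _ _]/(algebraic_multiplicity B 1) mB.
have mon1 : ('X - 1%:P : {poly K}) ^+ 2 \is monic.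
  by rewrite monic_exp ?monicXsubC.
move=> /dvdp_size_eqp; rewrite size_exp_XsubC size_char_poly eqxx => /esym.
rewrite eqp_monic ?char_poly_monic // expr2 mul_XsubC2 char_poly_mx22.
by move=> /eqP /monic_quadratic_inj[]; rewrite mxtrace_mx22 det_mx22 mulr1.
Qed.

Lemma geometric_multiplicity_id {K : realType} :
  geometric_multiplicity (1%:M : 'M[K]_2) 1 = 2%N.
Proof.
rewrite /geometric_multiplicity /col_eigenspace /eigenspace trmx1 subrr.
by rewrite mxrank_ker mxrank0.
Qed.

Lemma Q_unit {K : realType} (nu : K) : Q nu \in unitmx.
Proof. by rewrite unitmxE det_mat2 mul1r mul0r subr0 unitr1. Qed.

Lemma invmx_Q {K : realType} (nu : K) : invmx (Q nu) = mat2 1 0 (- nu) 1.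
Proof.
rewrite -[RHS]mul1mx -(mulVmx (Q_unit nu)) -mulmxA mat2M.
by rewrite !mul0r !mul1r !mulr0 !mulr1 !addr0 add0r subrr mat2_1 mulmx1.
Qed.

Lemma swap_unit {K : realType} : mat2 0 1 1 0 \in @unitmx K 2.
Proof. by rewrite unitmxE det_mat2 mul0r mul1r sub0r unitrN1. Qed.

Lemma invmx_swap {K : realType} : invmx (mat2 0 1 1 0) = mat2 0 1 1 0 :> 'M[K]_2.
Proof.
rewrite -[RHS]mul1mx -(mulVmx swap_unit) -mulmxA mat2M.
by rewrite !mul0r !mulr0 !mulr1 !addr0 add0r mat2_1 mulmx1.
Qed.

Section MainArgument.
Context {K : realType} (p : bcnf K) (X Y : word).
Context (Xn : X <> [::]) (Yn : Y <> [::]) (XY : nth L X 0 <> nth L Y 0).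
Context (freq : frequently (good_period p X Y)).
Context (alg : algebraic_multiplicity (M p X) 1 = 2%N)
           (geo : geometric_multiplicity (M p X) 1 = 1%N).

(* Otherwise the x-coordinate is driven by affine maps independently of y, and
   the points k - 1 and k of a long cycle lie on the same side of x = 0. *)
Lemma vertical_not_eigenvector : M p X 0 1 != 0.
Proof.
apply/eqP => b0; have [trE detE] := double_unit_eigenvalue alg.
move: trE detE (mat2_eta (M p X)); rewrite b0 mul0r subr0.
set a := M p X 0 0; set d := M p X 1 1; set c := M p X 1 0 => trE detE MXE.
have a1 : a = 1.
  have : (a - 1) ^+ 2 = 0.
    transitivity (a * (a + d) - a * d - 2 * a + 1); first by ring.
    by rewrite trE detE; ring.
  by move/eqP; rewrite sqrf_eq0 subr_eq0 => /eqP.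
have d1 : d = 1 by apply: (addrI 1); rewrite -{1}a1 trE.
rewrite a1 d1 in MXE.
have c0 : c != 0.
  by apply/eqP => c0; move: geo; rewrite -MXE c0 mat2_1 geometric_multiplicity_id.
have MX : conjM p (mat2 0 1 1 0) X = mat2 1 c 0 1.
  by rewrite /conjM invmx_swap -MXE !mat2M; congr mat2; ring.
have [_ _ g22N1] := cycles_shear_orbits swap_unit MX (esym (cvec_eta _))
  (esym (mat2_eta _)) (esym (cvec_eta _)) Xn Yn XY c0 freq.
move=> fr; apply: (orbit_v_no_sign_change g22N1).
apply: frequentlyS fr => k [uv o neg]; exists uv; first exact: o.
by move: neg; rewrite !mat2_cvec /xcoord !mxE /= !mul0r !mul1r !add0r.
Qed.

Lemma eigenslope_unique :
  unique (eigenslope p X) ((1 - M p X 0 0) / M p X 0 1).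
Proof.
have b0 := vertical_not_eigenvector; have [trE detE] := double_unit_eigenvalue alg.
have eig nu : ((cvec 1 nu)^T <= col_eigenspace (M p X) 1)%MS =
              (nu == (1 - M p X 0 0) / M p X 0 1).
  apply/eigenspaceP/eqP; rewrite scale1r -trmx_mul.
    move/trmx_inj; rewrite -{1}(mat2_eta (M p X)) mat2_cvec.
    move/(congr1 (fun z : 'cV[K]_2 => z 0 0)); rewrite !mxE /= => <-.
    by field.
  move=> ->; congr trmx; rewrite -{1}(mat2_eta (M p X)) mat2_cvec.
  move: (M p X 0 0) (M p X 0 1) (M p X 1 0) (M p X 1 1) b0 trE detE
    => a b c d b0 trE detE.
  have dE : d = 2 - a by rewrite -trE; ring.
  have cE : c = (a * d - 1) / b by rewrite -detE; field.
  by congr cvec; rewrite ?cE ?dE; field.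
have rk nu : \rank (cvec 1 nu : 'cV[K]_2)^T = 1%N.
  rewrite mxrank_tr; apply/eqP; rewrite eqn_leq rank_leq_col lt0n mxrank_eq0.
  by apply/eqP => /colP/(_ 0); rewrite !mxE /= => /eqP; rewrite oner_eq0.
split.
  have le : ((cvec 1 ((1 - M p X 0 0) / M p X 0 1))^T
             <= col_eigenspace (M p X) 1)%MS.
    by rewrite eig.
  rewrite /eigenslope; have [_] := mxrank_leqif_eq le.
  rewrite rk -[\rank _]/(geometric_multiplicity _ _) geo eqxx => /esym.
  by rewrite andbC.
by move=> nu /andP[_]; rewrite eig => /eqP.
Qed.

Lemma conjM_Q :
  conjM p (Q ((1 - M p X 0 0) / M p X 0 1)) X = mat2 1 (M p X 0 1) 0 1.
Proof.
have b0 := vertical_not_eigenvector; have [trE detE] := double_unit_eigenvalue alg.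
rewrite /conjM invmx_Q -[X in _ *m X *m _]mat2_eta /Q !mat2M.
move: (M p X 0 0) (M p X 0 1) (M p X 1 0) (M p X 1 1) b0 trE detE
    => a b c d b0 trE detE.
have dE : d = 2 - a by rewrite -trE; ring.
have cE : c = (a * d - 1) / b by rewrite -detE; field.
by congr mat2; rewrite ?cE ?dE; field.
Qed.

End MainArgument.

Lemma det_M_area_preserving {K : realType} (p : bcnf K) S :
  deltaL p = 1 -> deltaR p = 1 -> \det (M p S) = 1.
Proof.
move=> dL dR; elim/last_ind: S => [|S J IH]; first by rewrite det1.
rewrite /M foldl_rcons -/(M p S) det_mulmx IH mulr1.
by case: J; rewrite det_mat2 ?dL ?dR; ring.
Qed.

Theorem theorem4p2 (K : realType) (p : bcnf K) (X Y : word)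
  (hX : X <> [::]) (hY : Y <> [::])
  (hXprim : primitive X)
  (hXY : nth L X 0 <> nth L Y 0)
  (hmu : mu p != 0)
  (hcycles : infinite_set [set k : nat | (1 <= k)%N /\
     exists z : 'cV[K]_2,
       [/\ unique (is_cycle p (XkY X Y k)) z,
           admissible p (XkY X Y k) z,
           stable p (XkY X Y k) &
           off_switching_manifold p (XkY X Y k) z]])
  (halg : algebraic_multiplicity (M p X) 1 = 2%N)
  (hgeo : geometric_multiplicity (M p X) 1 = 1%N) :
  exists nu : K, unique (eigenslope p X) nu /\
  exists omega12 rho1 rho2 gamma11 gamma12 gamma21 gamma22 sigma1 sigma2 : K,
    [/\ omega12 != 0,
        (forall w : 'cV[K]_2,
           gword p nu X w = mat2 1 omega12 0 1 *m w + cvec rho1 rho2) &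
        (forall w : 'cV[K]_2,
           gword p nu Y w =
           mat2 gamma11 gamma12 gamma21 gamma22 *m w + cvec sigma1 sigma2)] /\
    [/\ gamma21 = 0, rho2 != 0 & gamma22 = -1] /\
    (forall (k : nat) (z : 'cV[K]_2),
       (1 <= k)%N -> is_cycle p (XkY X Y k) z ->
       perm_eq (stability_multipliers p (XkY X Y k)) [:: gamma11%:C; -1] /\
       ~~ attracting p (XkY X Y k)) /\
    (deltaL p = 1 -> deltaR p = 1 -> gamma11 = -1).
Proof.
have freq : frequently (good_period p X Y) := infinite_frequently hcycles.
have b0 := vertical_not_eigenvector hX hY hXY freq halg hgeo.
have MX := conjM_Q hX hY hXY freq halg hgeo.
have eig := eigenslope_unique hX hY hXY freq halg hgeo.
move: MX eig; set nu := _ / _ => MX eig; exists nu; split=> //.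
have Qu := Q_unit nu.
pose G := conjM p (Q nu) Y.
pose r := conjw p (Q nu) X 0; pose s := conjw p (Q nu) Y 0.
have X0 : conjw p (Q nu) X 0 = cvec (r 0 0) (r 1 0) by rewrite cvec_eta.
have MY : conjM p (Q nu) Y = mat2 (G 0 0) (G 0 1) (G 1 0) (G 1 1).
  by rewrite mat2_eta.
have Y0 : conjw p (Q nu) Y 0 = cvec (s 0 0) (s 1 0) by rewrite cvec_eta.
have [g21 g11N1 g22N1 fr] :=
  cycles_shear_orbits Qu MX X0 MY Y0 hX hY hXY b0 freq.
have [r20 g22] : r 1 0 != 0 /\ G 1 1 = -1.
  apply: (orbit_u_sign_change g11N1 g22N1 b0); apply: frequentlyS fr.
  move=> k [uv o neg]; exists uv; first exact: o.
  by move: neg; rewrite !mat2_cvec /xcoord !mxE /= !mul0r !mul1r !addr0.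
exists (M p X 0 1), (r 0 0), (r 1 0), (G 0 0), (G 0 1), (G 1 0), (G 1 1),
  (s 0 0), (s 1 0).
split; first split=> // w.
- by rewrite -[LHS]/(conjw p (Q nu) X w) conjwE MX X0.
- by rewrite -[LHS]/(conjw p (Q nu) Y w) conjwE MY Y0.
split; first by split.
split=> [k z _ _|dL dR]; last first.
  have := det_conjM p Qu Y; rewrite MY det_mat2 g21 g22 det_M_area_preserving //.
  by rewrite mulr0 subr0 mulrN1 => <-; rewrite opprK.
have pe : perm_eq (stability_multipliers p (XkY X Y k)) [:: (G 0 0)%:C; -1].
  rewrite -(rmorphN1 (real_complex K)); apply: stability_multipliersP.
    by rewrite (mxtrace_XkY Qu MX MY) g21 g22; ring.
  by rewrite (det_XkY Qu MX MY) g21 g22; ring.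
split=> //; rewrite /attracting (perm_all _ pe) /= normrN1 ltxx.
by rewrite andbF.
Qed.
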